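(* Let $q\ge 5$ be an integer and let $k$ be an integer with $2\le k\le 11$. Let $(s^k)_n$ denote the sum of the $k$-th powers of all elements of row $n$ of the hyperbolic Pascal triangle $\mathcal{HPT}_{4,q}$. Put $d=\lfloor k/2\rfloor+3$. Then for all $n\ge d+1$, $$(s^k)_n=\sum_{j=1}^{d}c_j(q)\,(s^k)_{n-j},$$ where the coefficients $(c_1(q),\dots,c_d(q))$ are the following: - $k=2$: $(q+2,\ -q-7,\ 8,\ -2)$; - $k=3$: $(q+4,\ q-19,\ -2q+18,\ -2)$; - $k=4$: $(q+7,\ 6q-41,\ -7q+31,\ 6,\ -2)$; - $k=5$: $(q+11,\ 18q-71,\ -9q-17,\ -10q+88,\ -10)$; - $k=6$: $(q+17,\ 44q-99,\ 17q-303,\ -62q+404,\ -14,\ -4)$; - $k=7$: $(q+26,\ 99q-68,\ 177q-1400,\ -235q+1183,\ -42q+302,\ -42)$; - $k=8$: $(q+40,\ 213q+206,\ 757q-4842,\ -717q+2981,\ -254q+1782,\ -162,\ -4)$; - $k=9$: $(q+62,\ 447q+1288,\ 2433q-15116,\ -2431q+10555,\ -450q+3662,\ -450,\ 0)$; - $k=10$: $(q+97,\ 924q+4782,\ 6096q-48560,\ -13946q+75623,\ 5903q-24351,\ 1022q-8408,\ 814,\ 4)$; - $k=11$: $(q+153,\ 1892q+15110,\ 9924q-181164,\ -99514q+592503,\ 78523q-360899,\ 9174q-74876,\ 9174,\ 0)$.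
   Context: The hyperbolic Pascal triangle $\mathcal{HPT}_{4,q}$ ($q\ge5$) is an array of rows of positive integers, each element having a type $A$ or $B$, built as follows. Row $0$ is the single element $1$. Row $1$ consists of two elements $1,1$, both of type $B$. The first and last elements of each row $n\ge 1$ (the wingers) have value $1$ and are regarded as type $B$. Given row $n\ge1$, with elements $x_0,x_1,\dots,x_{s_n-1}$ from left to right, row $n+1$ consists, from left to right, of: a left winger of value $1$ (type $B$); then an element $x_0+x_1$ of type $A$; then, for each $i=1,\dots,s_n-2$ in order, first $q-4$ copies of $x_i$ (if $x_i$ has type $A$) or $q-3$ copies of $x_i$ (if $x_i$ has type $B$), all of these copies having type $B$, followed by an element $x_i+x_{i+1}$ of type $A$; and finally a right winger of value $1$ (type $B$). (For instance row $2$ is $1,2,1$, and row $3$ is $1,3,2,\dots,2,3,1$ with $q-4$ copies of $2$.) Here $s_n$ is the number of elements of row $n$, and $(s^k)_n=\sum_{i=0}^{s_n-1}x_i^k$, the sum being over the elements $x_i$ of row $n$. *)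

(* Defs.v *)
From Stdlib Require Import ZArith List.
Import ListNotations.
Open Scope Z_scope.

Variant hpt_type := TypeA | TypeB.

Definition hpt_elt : Type := (Z * hpt_type)%type.

(* The value x_i and the type of x_i in a row r, indexed from 0; the default is
   never reached when a row n >= 1 is extended. *)
Definition hpt_val (r : list hpt_elt) (i : nat) : Z := fst (nth i r (1, TypeB)).
Definition hpt_typ (r : list hpt_elt) (i : nat) : hpt_type :=
  snd (nth i r (1, TypeB)).

Definition hpt_copies (q : Z) (t : hpt_type) : nat :=
  match t with
  | TypeA => Z.to_nat (q - 4)
  | TypeB => Z.to_nat (q - 3)
  end.

(* In flat_map, i runs over 1, ..., s - 2 with s = length r, i.e. over the
   positions of r other than the two wingers. *)
Definition hpt_next (q : Z) (r : list hpt_elt) : list hpt_elt :=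
  [(1, TypeB); (hpt_val r 0 + hpt_val r 1, TypeA)]
  ++ flat_map
       (fun i => repeat (hpt_val r i, TypeB) (hpt_copies q (hpt_typ r i))
                 ++ [(hpt_val r i + hpt_val r (S i), TypeA)])
       (seq 1 (length r - 2))
  ++ [(1, TypeB)].

(* The type attached to the single element of row 0 is a dummy: row 1 is
   prescribed, and hpt_next is only applied to rows n >= 1. *)
Fixpoint hpt_row (q : Z) (n : nat) : list hpt_elt :=
  match n with
  | O => [(1, TypeB)]
  | S O => [(1, TypeB); (1, TypeB)]
  | S m => hpt_next q (hpt_row q m)
  end.

Definition Zsum (l : list Z) : Z := fold_right Z.add 0 l.

(* (s^k)_n *)
Definition hpt_power_sum (q : Z) (k n : nat) : Z :=
  Zsum (map (fun x : hpt_elt => fst x ^ Z.of_nat k) (hpt_row q n)).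

(* The tuple (c_1(q), ..., c_d(q)) for 2 <= k <= 11, with d = k / 2 + 3. *)
Definition hpt_coefs (k : nat) (q : Z) : list Z :=
  match k with
  | 2%nat => [q + 2; - q - 7; 8; - 2]
  | 3%nat => [q + 4; q - 19; - 2 * q + 18; - 2]
  | 4%nat => [q + 7; 6 * q - 41; - 7 * q + 31; 6; - 2]
  | 5%nat => [q + 11; 18 * q - 71; - 9 * q - 17; - 10 * q + 88; - 10]
  | 6%nat => [q + 17; 44 * q - 99; 17 * q - 303; - 62 * q + 404; - 14; - 4]
  | 7%nat => [q + 26; 99 * q - 68; 177 * q - 1400; - 235 * q + 1183;
              - 42 * q + 302; - 42]
  | 8%nat => [q + 40; 213 * q + 206; 757 * q - 4842; - 717 * q + 2981;
              - 254 * q + 1782; - 162; - 4]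
  | 9%nat => [q + 62; 447 * q + 1288; 2433 * q - 15116; - 2431 * q + 10555;
              - 450 * q + 3662; - 450; 0]
  | 10%nat => [q + 97; 924 * q + 4782; 6096 * q - 48560; - 13946 * q + 75623;
               5903 * q - 24351; 1022 * q - 8408; 814; 4]
  | 11%nat => [q + 153; 1892 * q + 15110; 9924 * q - 181164;
               - 99514 * q + 592503; 78523 * q - 360899; 9174 * q - 74876;
               9174; 0]
  | _ => []
  end.

(* c_j(q), with j counted from 1. *)
Definition hpt_coef (k : nat) (q : Z) (j : nat) : Z :=
  nth (j - 1) (hpt_coefs k q) 0.

(* Main.v *)
Require Import Defs.
From Stdlib Require Import ZArith List.
From Stdlib Require Import Lia.
Import ListNotations.
Open Scope Z_scope.

(** Let T_n(f) be the sum of f(x, y) over all pairs of adjacent elements x, y of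
    row n.  A pair (x, y) produces in the next row the pairs (x, x + y) and
    (x + y, y), and all remaining pairs of the next row join two copies of the
    same element.  Hence, for f homogeneous of degree k,
    T_(n+1)(f) = T_n(D f) + f(1, 1) b_n, where (D f)(x, y) = f(x, x + y) + f(x + y, y)
    and b_n is the sum of (m_i - 1) x_i^k, m_i being the number of copies of x_i.
    On the one hand T_n(x^k + y^k) = 2 (s^k)_n - 2, on the other hand
    b_(n+1) - b_n is a combination of (s^k)_(n+1) and (s^k)_n up to a constant.
    So every linear relation between the forms D^j (x^k + y^k), after taking
    second differences, is a linear recurrence for (s^k)_n alone. *)

Lemma Zsum_app (l l' : list Z) : Zsum (l ++ l') = Zsum l + Zsum l'.
Proof. induction l as [|a l IH]; cbn; [reflexivity|]. fold (Zsum l) (Zsum (l ++ l')). lia. Qed.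

Lemma Zsum_cons (a : Z) (l : list Z) : Zsum (a :: l) = a + Zsum l.
Proof. reflexivity. Qed.

Lemma Zsum_map_repeat {A : Type} (g : A -> Z) (a : A) (m : nat) :
  Zsum (map g (repeat a m)) = Z.of_nat m * g a.
Proof.
  induction m as [|m IH]; [reflexivity|].
  cbn [repeat map]. rewrite Zsum_cons, IH. lia.
Qed.

(** * The interior of a row *)

(* The elements of the next row strictly between its element a (the last copy
   of the current one) and its right winger, when the current row continues
   after a with mid and its right winger. *)
Fixpoint grow (q a : Z) (mid : list hpt_elt) : list hpt_elt :=
  match mid with
  | [] => [(a + 1, TypeA)]
  | x :: t => (a + fst x, TypeA) ::
      repeat (fst x, TypeB) (hpt_copies q (snd x)) ++ grow q (fst x) t
  end.

(** The index is shifted by one: index 0 stands for row 1, which has only its two wingers. *)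
Definition interior (q : Z) (n : nat) : list hpt_elt := Nat.iter n (grow q 1) [].

Definition framed (mid : list hpt_elt) : list hpt_elt :=
  (1, TypeB) :: mid ++ [(1, TypeB)].

Lemma hpt_next_framed (q : Z) (mid : list hpt_elt) :
  hpt_next q (framed mid) = framed (grow q 1 mid).
Proof.
  (* The induction needs an arbitrary left neighbour [e]: after one step the first interior element
     takes over the role of the left winger. *)
  assert (gen : forall mid e,
    let r := e :: mid ++ [(1, TypeB)] in
    (hpt_val r 0 + hpt_val r 1, TypeA) ::
      flat_map
       (fun i => repeat (hpt_val r i, TypeB) (hpt_copies q (hpt_typ r i))
                 ++ [(hpt_val r i + hpt_val r (S i), TypeA)])
       (seq 1 (length mid)) = grow q (fst e) mid).
  { clear mid. intros mid. induction mid as [|x t IH]; intros e r; [reflexivity|].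
    cbn [grow]. rewrite <- (IH x). cbn [length seq flat_map].
    rewrite <- (seq_shift (length t) 1), flat_map_concat_map, map_map,
      <- flat_map_concat_map.
    unfold r; cbn. now rewrite <- app_assoc. }
  specialize (gen mid (1, TypeB)). cbn [fst] in gen.
  unfold hpt_next.
  replace (length (framed mid) - 2)%nat with (length mid)
    by (cbn; rewrite length_app; cbn; lia).
  unfold framed at 5. rewrite <- gen. reflexivity.
Qed.

Lemma hpt_row_framed (q : Z) (n : nat) : hpt_row q (S n) = framed (interior q n).
Proof.
  induction n as [|n IH]; [reflexivity|].
  change (hpt_row q (S (S n))) with (hpt_next q (hpt_row q (S n))).
  rewrite IH. apply hpt_next_framed.
Qed.

Definition inner_sum (k : nat) (mid : list hpt_elt) : Z :=
  Zsum (map (fun x : hpt_elt => fst x ^ Z.of_nat k) mid).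

Lemma hpt_power_sum_interior (q : Z) (k n : nat) :
  hpt_power_sum q k (S n) = inner_sum k (interior q n) + 2.
Proof.
  unfold hpt_power_sum, inner_sum. rewrite hpt_row_framed. unfold framed.
  cbn [map]. rewrite map_app, Zsum_cons, Zsum_app. cbn [map fst].
  rewrite Zsum_cons, Z.pow_1_l by lia. change (Zsum []) with 0. lia.
Qed.

(* The sum of x^k over the adjacent pairs (x, x) of two copies of one element
   that mid produces in the next row. *)
Definition twin_sum (q : Z) (k : nat) (mid : list hpt_elt) : Z :=
  Zsum (map (fun x : hpt_elt =>
    (Z.of_nat (hpt_copies q (snd x)) - 1) * fst x ^ Z.of_nat k) mid).

(** A new element of type A has weight q - 5, a copy (type B) has weight (q - 5) + 1. The surplus is
    the sum of m_i x_i^k, where m_i = (m_i - 1) + 1. *)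
Lemma twin_sum_grow (q : Z) (k : nat) (a : Z) (mid : list hpt_elt) :
  5 <= q ->
  twin_sum q k (grow q a mid) =
  (q - 5) * inner_sum k (grow q a mid) + twin_sum q k mid + inner_sum k mid.
Proof.
  intros hq. unfold twin_sum, inner_sum.
  revert a. induction mid as [|x t IH]; intros a; cbn [grow map].
  - rewrite !Zsum_cons. change (Zsum []) with 0. cbn [fst snd hpt_copies].
    rewrite Z2Nat.id by lia. ring.
  - rewrite !map_app, !Zsum_cons, !Zsum_app, IH, !Zsum_map_repeat.
    cbn [fst snd]. cbn [hpt_copies]. rewrite !Z2Nat.id by lia.
    unfold hpt_elt in *. ring.
Qed.

(** * Sums over adjacent pairs *)

Definition form := Z -> Z -> Z.

(* The sum of f over the adjacent pairs of the list a, mid, 1. *)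
Fixpoint link_sum (f : form) (a : Z) (mid : list hpt_elt) : Z :=
  match mid with
  | [] => f a 1
  | x :: t => f a (fst x) + link_sum f (fst x) t
  end.

Definition split_form (f : form) : form := fun x y => f x (x + y) + f (x + y) y.

Definition homogeneous (k : nat) (f : form) : Prop :=
  forall c x y, f (c * x) (c * y) = c ^ Z.of_nat k * f x y.

Definition power_form (k : nat) : form :=
  fun x y => x ^ Z.of_nat k + y ^ Z.of_nat k.

Lemma homogeneous_power_form (k : nat) : homogeneous k (power_form k).
Proof. intros c x y. unfold power_form. rewrite !Z.pow_mul_l. ring. Qed.

Lemma homogeneous_split_form (k : nat) (f : form) :
  homogeneous k f -> homogeneous k (split_form f).
Proof.
  intros hf c x y. unfold split_form.
  rewrite <- Z.mul_add_distr_l, !hf. ring.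
Qed.

Lemma homogeneous_iter_split (k j : nat) (f : form) :
  homogeneous k f -> homogeneous k (Nat.iter j split_form f).
Proof.
  intros hf. induction j as [|j IH]; [exact hf|]. now apply homogeneous_split_form.
Qed.

Lemma link_sum_repeat (f : form) (x : Z) (t : hpt_type) (m : nat) (l : list hpt_elt) :
  link_sum f x (repeat (x, t) m ++ l) = Z.of_nat m * f x x + link_sum f x l.
Proof.
  induction m as [|m IH]; [reflexivity|].
  cbn [repeat app link_sum fst]. rewrite IH. lia.
Qed.

Lemma link_sum_grow (q : Z) (k : nat) (f : form) (a : Z) (mid : list hpt_elt) :
  5 <= q -> homogeneous k f ->
  link_sum f a (grow q a mid) =
  link_sum (split_form f) a mid + f 1 1 * twin_sum q k mid.
Proof.
  intros hq hf. unfold twin_sum.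
  revert a. induction mid as [|x t IH]; intros a.
  - cbn. unfold split_form. ring.
  - cbn [grow link_sum map fst]. rewrite Zsum_cons.
    (* As 5 <= q, there is at least one copy of [x]; m + 1 copies form m twin pairs. *)
    destruct (hpt_copies q (snd x)) as [|m] eqn:hm.
    { destruct (snd x); cbn in hm; lia. }
    cbn [repeat app link_sum fst]. rewrite link_sum_repeat, IH, Nat2Z.inj_succ.
    assert (hx : f (fst x) (fst x) = fst x ^ Z.of_nat k * f 1 1).
    { now rewrite <- hf, Z.mul_1_r. }
    rewrite hx. unfold split_form. ring.
Qed.

(** Each interior element lies in two adjacent pairs, the end values [a] and 1 in one each. *)
Lemma link_sum_power_form (k : nat) (a : Z) (mid : list hpt_elt) :
  link_sum (power_form k) a mid = a ^ Z.of_nat k + 2 * inner_sum k mid + 1.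
Proof.
  unfold inner_sum. revert a. induction mid as [|x t IH]; intros a.
  - cbn [link_sum]. unfold power_form. rewrite Z.pow_1_l by lia. change (Zsum (map _ [])) with 0. lia.
  - cbn [link_sum map]. rewrite IH, Zsum_cons. unfold power_form. lia.
Qed.

Lemma link_sum_comb {I : Type} (c : I -> Z) (F : I -> form) (l : list I)
    (a : Z) (mid : list hpt_elt) :
  link_sum (fun x y => Zsum (map (fun j => c j * F j x y) l)) a mid =
  Zsum (map (fun j => c j * link_sum (F j) a mid) l).
Proof.
  revert a. induction mid as [|x t IH]; intros a; [reflexivity|].
  cbn [link_sum]. rewrite IH. clear IH.
  induction l as [|j l IHl]; [reflexivity|].
  cbn [map]. rewrite !Zsum_cons, <- IHl. ring.
Qed.

Lemma link_sum_zero (f : form) (a : Z) (mid : list hpt_elt) :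
  (forall x y, f x y = 0) -> link_sum f a mid = 0.
Proof.
  intros hf. revert a. induction mid as [|x t IH]; intros a; cbn [link_sum].
  - apply hf.
  - now rewrite hf, IH.
Qed.

(** * The recurrence attached to a relation between forms *)

Definition diff2 (u : nat -> Z) (n : nat) : Z :=
  u (S (S n)) - 2 * u (S n) + u n.

(* Solving w_(n+1)(f) = w_n(D f) + f(1, 1) g_n for w_n(D^j f). *)
Lemma iter_split_unfold (k : nat) (w : form -> nat -> Z) (g : nat -> Z)
    (hw : forall f n, homogeneous k f -> w f (S n) = w (split_form f) n + f 1 1 * g n)
    (f : form) (hf : homogeneous k f) (j n : nat) :
  w (Nat.iter j split_form f) n =
  w f (j + n)%nat -
  Zsum (map (fun i => Nat.iter (j - 1 - i) split_form f 1 1 * g (i + n)%nat) (seq 0 j)).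
Proof.
  revert n. induction j as [|j IH]; intros n.
  - cbn. ring.
  - cbn [seq map]. rewrite <- seq_shift, map_map, Zsum_cons.
    assert (e := hw _ n (homogeneous_iter_split k j f hf)).
    rewrite IH in e. replace (S j - 1 - 0)%nat with j by lia.
    replace (j + S n)%nat with (S j + n)%nat in e by lia.
    rewrite (map_ext (fun i => _ * g (S i + n)%nat)
      (fun i => Nat.iter (j - 1 - i) split_form f 1 1 * g (i + S n)%nat)).
    + change (Nat.iter (S j) split_form f) with (split_form (Nat.iter j split_form f)).
      change (0 + n)%nat with n. lia.
    + intros i. replace (S j - 1 - S i)%nat with (j - 1 - i)%nat by lia.
      now replace (S i + n)%nat with (i + S n)%nat by lia.
Qed.

Lemma power_sum_recurrence (q : Z) (k : nat) (p : list Z) (n : nat) :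
  5 <= q ->
  (forall x y, Zsum (map
     (fun j => nth j p 0 * Nat.iter j split_form (power_form k) x y)
     (seq 0 (length p))) = 0) ->
  let s i := hpt_power_sum q k (S i) in
  let ds i := s (S i) - s i in
  Zsum (map (fun j => nth j p 0 *
     (2 * diff2 s (j + n)%nat -
      Zsum (map (fun i => Nat.iter (j - 1 - i) split_form (power_form k) 1 1 *
                          ((q - 5) * ds (S (i + n)) + ds (i + n)%nat)) (seq 0 j))))
     (seq 0 (length p))) = 0.
Proof.
  intros hq hp s ds.
  set (v := fun f i => link_sum f 1 (interior q i)).
  set (b := fun i => twin_sum q k (interior q i)).
  set (w := fun f => diff2 (v f)).
  assert (hs : forall i, s i = inner_sum k (interior q i) + 2)
    by (intros i; apply hpt_power_sum_interior).
  assert (hv : forall f i, homogeneous k f -> v f (S i) = v (split_form f) i + f 1 1 * b i)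
    by (intros f i hf; exact (link_sum_grow q k f 1 (interior q i) hq hf)).
  assert (hw : forall f i, homogeneous k f ->
            w f (S i) = w (split_form f) i + f 1 1 * diff2 b i).
  { intros f i hf. unfold w, diff2. rewrite !(hv f) by exact hf. ring. }
  assert (hb : forall i, b (S i) = (q - 5) * (s (S i) - 2) + b i + (s i - 2)).
  { intros i. rewrite !hs. unfold b. change (interior q (S i)) with (grow q 1 (interior q i)).
    rewrite twin_sum_grow by exact hq. ring. }
  (* The constants due to the wingers cancel in the second difference. *)
  assert (hb2 : forall i, diff2 b i = (q - 5) * ds (S i) + ds i).
  { intros i. unfold diff2, ds. rewrite !hb. ring. }
  assert (hw0 : forall i, w (power_form k) i = 2 * diff2 s i).
  { intros i. unfold w, diff2, v. rewrite !link_sum_power_form, !hs. ring. }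
  assert (hcomb : forall i, Zsum (map (fun j => nth j p 0 *
            v (Nat.iter j split_form (power_form k)) i) (seq 0 (length p))) = 0).
  { intros i. unfold v. rewrite <- (link_sum_comb (fun j => nth j p 0)).
    apply link_sum_zero. exact hp. }
  transitivity (Zsum (map (fun j => nth j p 0 *
     w (Nat.iter j split_form (power_form k)) n) (seq 0 (length p)))).
  - f_equal. apply map_ext. intros j.
    rewrite (iter_split_unfold k w (diff2 b) hw _ (homogeneous_power_form k)), hw0.
    do 3 f_equal. apply map_ext. intros i. now rewrite hb2.
  - transitivity (diff2 (fun i => Zsum (map (fun j => nth j p 0 *
            v (Nat.iter j split_form (power_form k)) i) (seq 0 (length p)))) n).
    + unfold w, diff2. clear hp hcomb. induction (seq 0 (length p)) as [|j l IH]; [reflexivity|].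
      cbn [map]. rewrite !Zsum_cons, IH. ring.
    + unfold diff2. now rewrite !hcomb.
Qed.

(* The coefficients, lowest j first, of a monic relation between the forms
   D^j (x^k + y^k).  It has minimal degree except for k = 10, where the minimal one
   is multiplied by D - 1: there the characteristic polynomial of the recurrence
   c_j(q) is z - 1 times the one obtained from the minimal relation. *)
Definition form_relation (k : nat) : list Z :=
  match k with
  | 2%nat => [2; - 5; 1]
  | 3%nat => [0; - 7; 1]
  | 4%nat => [2; - 9; - 10; 1]
  | 5%nat => [0; - 47; - 14; 1]
  | 6%nat => [4; - 40; - 161; - 20; 1]
  | 7%nat => [0; - 327; - 485; - 29; 1]
  | 8%nat => [4; - 84; - 1401; - 1357; - 43; 1]
  | 9%nat => [0; - 3843; - 3653; - 65; 1]
  | 10%nat => [- 4; 200; 9605; - 100; - 9602; - 100; 1]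
  | 11%nat => [0; 107529; 83828; - 24882; - 156; 1]
  | _ => []
  end.

Lemma form_relation_holds (k : nat) (x y : Z) :
  Zsum (map (fun j => nth j (form_relation k) 0 *
     Nat.iter j split_form (power_form k) x y)
     (seq 0 (length (form_relation k)))) = 0.
Proof.
  (* For 2 <= k <= 11 this is a polynomial identity in x and y; for other k the list is empty. *)
  do 12 (destruct k as [|k];
    [cbn -[Z.mul Z.add Z.pow]; unfold split_form, power_form;
     cbn -[Z.mul Z.add Z.pow]; ring|]).
  reflexivity.
Qed.

Theorem mainTheorem1 :
  forall (q : Z) (k d n : nat),
    5 <= q ->
    (2 <= k <= 11)%nat ->
    d = (k / 2 + 3)%nat ->
    (d + 1 <= n)%nat ->
    hpt_power_sum q k n =
    Zsum (map (fun j => hpt_coef k q j * hpt_power_sum q k (n - j)) (seq 1 d)).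
Proof.
  intros q k d n hq hk hd hn.
  (* With this offset the highest row that occurs is row n: [diff2] reaches two indices ahead, and
     index i means row i + 1. *)
  assert (H := power_sum_recurrence q k (form_relation k)
    (n - (length (form_relation k) + 2)) hq (form_relation_holds k)).
  destruct (Nat.le_exists_sub _ _ hn) as [m [hm _]].
  rewrite Nat.add_comm in hm. subst n d. clear hn.
  cbv zeta in H. revert H. generalize (hpt_power_sum q k) as s. intros s H.
  (* The relation is monic and contains 2 [diff2 s], so twice the difference of the two sides equals
     the left side of [H], as a formal identity in q and the values of [s]. *)
  apply (Z.mul_reg_l _ _ 2); [lia|]. apply Zminus_eq. rewrite <- H. unfold diff2.
  clear hq H.
  do 2 (destruct k as [|k]; [lia|]).
  do 10 (destruct k as [|k]; [
    clear hk; cbn -[Z.mul Z.add Z.sub Z.opp split_form power_form];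
    repeat match goal with |- context [split_form ?f 1 1] =>
      let h := eval vm_compute in (split_form f 1 1) in
      change (split_form f 1 1) with h end;
    change (power_form _ 1 1) with 2;
    rewrite ?Nat.sub_0_r; ring|]).
  lia.
Qed.
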